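(* Let $G$ be a group and $(X,\pi)$ a separable reflexive isometric Banach $G$-module. Assume that $F\leqslant G$ is a subgroup with $X^{\mathsf{FC}_G(F)}=\{0\}$. Then the restriction map $$\overline{H}^n(G,X)\to \overline{H}^n(F,X)$$ is zero for all $n\geqslant 0$. In particular, if $G$ acts on $X$ by an affine isometric action $\alpha$ with linear part $\pi$, then $F$ has almost fixed points on $X$, i.e. for every finite $E\subseteq F$ and $\epsilon>0$ there is $x\in X$ with $\|x-\alpha(f)x\|<\epsilon$ for all $f\in E$.
   Context: All Banach spaces are real and groups are discrete. A Banach $G$-module is a pair $(X,\pi)$ with $X$ a Banach space and $\pi$ an action of $G$ on $X$ by bounded linear automorphisms; it is isometric if each $\pi(g)$ is an isometry, and separable (reflexive) if $X$ is. For $H\leqslant G$, $X^H=\{x\in X:\pi(h)x=x\ \forall h\in H\}$ and $X$ is an $H$-module by restricting $\pi$. For a subgroup $F\leqslant G$, $\mathsf{FC}_G(F)=\{g\in G: \{fgf^{-1}: f\in F\}\text{ is finite}\}$, a subgroup of $G$. $C^n(G,X)$ is the vector space of all maps $G^n\to X$ (with $C^0(G,X)=X$), with the topology of pointwise convergence. The coboundary operator $\partial^{n+1}:C^n(G,X)\to C^{n+1}(G,X)$ is $$(\partial^{n+1}\phi)(g_1,\ldots,g_{n+1})=-\pi(g_1)\phi(g_2,\ldots,g_{n+1})+(-1)^n\phi(g_1,\ldots,g_n)-\sum_{i=1}^n(-1)^i\phi(g_1,\ldots,g_{i-1},g_ig_{i+1},g_{i+2},\ldots,g_{n+1}),$$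 and $\partial^0:\{0\}\to C^0(G,X)$ is the zero map. $Z^n(G,X)=\ker\partial^{n+1}$, $B^n(G,X)=\operatorname{range}\partial^n$, and the reduced cohomology is $\overline{H}^n(G,X)=Z^n(G,X)/\overline{B^n(G,X)}$, with closure taken in $C^n(G,X)$. The restriction map is induced by $\phi\mapsto\phi|_{F^n}$. An affine isometric action $\alpha$ with linear part $\pi$ is an action of the form $\alpha(g)x=\pi(g)x+\phi(g)$ with $\phi\in Z^1(G,X)$. *)

(* Defs.v *)
From HB Require Import structures.
From mathcomp Require Import all_boot all_order all_algebra.
From mathcomp Require Import all_classical all_reals all_analysis.

Set Implicit Arguments.
Unset Strict Implicit.
Unset Printing Implicit Defensive.

Import Order.TTheory GRing.Theory Num.Theory.
Import numFieldNormedType.Exports.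
Local Open Scope classical_set_scope.
Local Open Scope ring_scope.
Local Open Scope quotient_scope.

Definition separable_space (T : topologicalType) : Prop :=
  exists2 D : set T, countable D & dense D.

Section Reflexive.
Variables (R : realType) (X : normedModType R).

Definition dual_space : set (X -> R^o) :=
  [set f | linear f /\ continuous f].

Definition dual_norm (f : X -> R^o) : R :=
  sup [set `|f x| | x in [set x : X | `|x| <= 1]].

(* An element of the bidual is represented by a function on all of X -> R of
   which only the values on the dual are constrained. *)
Definition bidual : set ((X -> R^o) -> R) :=
  [set Phi | (forall (a : R) (f g : X -> R^o), dual_space f -> dual_space g ->
                Phi (a *: f + g) = a * Phi f + Phi g) /\
             (exists C : R, forall f, dual_space f -> `|Phi f| <= C * dual_norm f)].

Definition reflexive_space : Prop :=
  forall Phi, bidual Phi -> exists x : X, forall f, dual_space f -> Phi f = f x.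

End Reflexive.

Record subgroup (G : groupType) (F : groupClosed G) :=
  Subgroup { subgroup_val : G; _ : subgroup_val \in F }.

Section SubgroupType.
Variables (G : groupType) (F : groupClosed G).

HB.instance Definition _ := [isSub for @subgroup_val G F].
HB.instance Definition _ := [Choice of subgroup F by <:].

Lemma subgroup_closed : group_closed [pred g : G | g \in F].
Proof. by split; [exact: gpred1|exact: gpredF]. Qed.

HB.instance Definition _ :=
  SubChoice_isSubGroup.Build G _ (subgroup F) subgroup_closed.

End SubgroupType.

Definition FC (G : groupType) (F : groupClosed G) : set G :=
  [set g | finite_set [set (f * g * f^-1)%g | f in [set f : G | f \in F]]].

(* Each [act g] is invertible because [act] is a group action. *)
Record banach_module (R : realType) (G : groupType)
    (X : completeNormedModType R) := BanachModule {
  act :> G -> {linear X -> X};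
  act_continuous : forall g, continuous (act g);
  act1 : forall x, act 1%g x = x;
  actM : forall g h x, act (g * h)%g x = act g (act h x)
}.

Section BanachModules.
Variables (R : realType) (G : groupType) (X : completeNormedModType R).
Implicit Types (pi : banach_module G X) (F : groupClosed G) (n : nat).

Definition isometric_module pi : Prop := forall g x, `|pi g x| = `|x|.

Definition fixed_points pi (H : set G) : set X :=
  [set x | forall h, H h -> pi h x = x].

Section Restriction.
Variables (pi : banach_module G X) (F : groupClosed G).

Let ract (f : subgroup F) : {linear X -> X} := pi (val f).

Let ract_continuous f : continuous (ract f).
Proof. exact: act_continuous. Qed.

Let ract1 x : ract 1%g x = x.
Proof. exact: act1. Qed.

Let ractM f g x : ract (f * g)%g x = ract f (ract g x).
Proof. exact: actM. Qed.

Definition res_module : banach_module (subgroup F) X :=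
  BanachModule ract_continuous ract1 ractM.

End Restriction.

End BanachModules.

Definition cochain (R : realType) (G : groupType)
    (X : completeNormedModType R) (n : nat) :=
  {ptws ('I_n -> G) -> X}.

HB.instance Definition _ R G X n :=
  GRing.Lmodule.copy (@cochain R G X n) (('I_n -> G) -> X).
HB.instance Definition _ R G X n :=
  Topological.copy (@cochain R G X n) {ptws ('I_n -> G) -> X}.

Lemma ptws_cvgP (I : Type) (V : topologicalType) (F : set_system {ptws I -> V})
    (f : {ptws I -> V}) : Filter F ->
  F --> f <-> forall t, (fun g : {ptws I -> V} => g t) @ F --> f t.
Proof.
move=> FF; split=> [/cvg_sup Ff t|Ff].
  apply: cvg_trans (@initial_continuous _ _ (fun g : I -> V => g t) f).
  exact/cvg_app/Ff.
apply/cvg_sup => t U [_ [[W oW <-] Wf WU]].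
by apply: (filterS WU); apply: Ff; exact: open_nbhs_nbhs.
Qed.

Section Cochains.
Variables (R : realType) (G : groupType) (X : completeNormedModType R).
Variable pi : banach_module G X.
Implicit Types n : nat.

(* With 0-based indices, [contract i] sends (g_0, ..., g_n) to
   (g_0, ..., g_i * g_(i+1), ..., g_n). *)
Definition contract n (i : 'I_n) (g : 'I_n.+1 -> G) : 'I_n -> G :=
  fun j => if (j < i)%N then g (lift ord_max j)
           else if j == i then (g (lift ord_max j) * g (lift ord0 j))%g
           else g (lift ord0 j).

(* [lift ord0] drops the first entry of a tuple and [lift ord_max] the last. *)
Definition coboundary n (phi : cochain G X n) : cochain G X n.+1 :=
  fun g =>
    - pi (g ord0) (phi (fun j => g (lift ord0 j)))
    + (-1) ^+ n *: phi (fun j => g (lift ord_max j))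
    - \sum_(i < n) (-1) ^+ i.+1 *: phi (contract i g).

Lemma coboundary_is_linear n : linear (@coboundary n).
Proof.
move=> a u v; apply/funext => g.
have E m (u' v' : cochain G X m) h : (a *: u' + v') h = a *: u' h + v' h by [].
rewrite E /coboundary !E.
have -> : \sum_(i < n) (-1) ^+ i.+1 *: (a *: u + v) (contract i g) =
    a *: (\sum_(i < n) (-1) ^+ i.+1 *: u (contract i g)) +
    \sum_(i < n) (-1) ^+ i.+1 *: v (contract i g).
  rewrite scaler_sumr -big_split /=; apply: eq_bigr => i _.
  by rewrite E scalerDr !scalerA mulrC.
rewrite linearP !scalerDr !scalerN !scalerA [a * _]mulrC !opprD.
by rewrite [X in X + (_ - _) = _]addrACA; exact: addrACA.
Qed.

HB.instance Definition _ n :=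
  GRing.isLinear.Build R (cochain G X n) (cochain G X n.+1) _ (@coboundary n)
    (@coboundary_is_linear n).

(* In degree 0, the range of the zero map from {0} to C^0(G, X). *)
Definition coboundaries n : set (cochain G X n) :=
  match n with
  | 0 => [set 0]
  | m.+1 => range (@coboundary m)
  end.

Record cocycle n :=
  Cocycle { cocycle_val :> cochain G X n; _ : coboundary cocycle_val == 0 }.

HB.instance Definition _ n := [isSub for @cocycle_val n].
HB.instance Definition _ n := [Choice of cocycle n by <:].

Lemma cocycle_submod_closed n :
  submod_closed [pred phi : cochain G X n | coboundary phi == 0].
Proof.
split=> [|a u v /eqP u0 /eqP v0]; apply/eqP; first exact: linear0.
by rewrite (coboundary_is_linear a u v) u0 v0 scaler0 addr0.
Qed.

HB.instance Definition _ n :=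
  GRing.SubChoice_isSubLmodule.Build R (cochain G X n) _ (cocycle n)
    (@cocycle_submod_closed n).

Lemma coboundariesB n (u v : cochain G X n) :
  coboundaries u -> coboundaries v -> coboundaries (u - v).
Proof.
case: n u v => [|n] u v; first by move=> -> ->; rewrite /= subr0.
by move=> [u' _ <-] [v' _ <-]; exists (u' - v') => //; exact: linearB.
Qed.

Lemma closure_coboundariesB n (u v : cochain G X n) :
  closure (@coboundaries n) u -> closure (@coboundaries n) v ->
  closure (@coboundaries n) (u - v).
Proof.
rewrite !closureEcvg => -[U PU [Uu UB]] [V PV [Vv VB]].
exists ((fun p => p.1 - p.2) @ filter_prod U V); last split.
- exact: fmap_proper_filter.
- apply/ptws_cvgP => t.
  have Ut : p.1 t @[p --> filter_prod U V] --> u t.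
    apply: (@cvg_comp _ _ _ fst (fun g : cochain G X n => g t) _ U).
      exact: cvg_fst.
    exact: (ptws_cvgP _ PU).1.
  have Vt : p.2 t @[p --> filter_prod U V] --> v t.
    apply: (@cvg_comp _ _ _ snd (fun g : cochain G X n => g t) _ V).
      exact: cvg_snd.
    exact: (ptws_cvgP _ PV).1.
  exact: cvgB Ut Vt.
- move=> A BA; exists (@coboundaries n, @coboundaries n) => /=.
    by split; [exact: UB|exact: VB].
  move=> [p q] [/= Bp Bq]; apply: BA.
  exact: coboundariesB.
Qed.

(* The closure of B^n is taken in the space of all n-cochains, for the topology
   of pointwise convergence; it lies in Z^n because Z^n is closed. *)
Definition closed_coboundary n : {pred cocycle n} :=
  fun z => `[< closure (@coboundaries n) (z : cochain G X n) >].

Lemma closed_coboundary_zmod n : zmod_closed (@closed_coboundary n).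
Proof.
split=> [|u v /asboolP uB /asboolP vB]; apply/asboolP.
  apply: subset_closure; case: n => [//|n]; exists 0 => //.
  exact: (linear0 (@coboundary n)).
exact: closure_coboundariesB.
Qed.

HB.instance Definition _ n :=
  GRing.isZmodClosed.Build (cocycle n) (@closed_coboundary n)
    (@closed_coboundary_zmod n).

Definition reduced_cohomology n := Quotient.quot (@closed_coboundary n).

End Cochains.

Section RestrictionMap.
Variables (R : realType) (G : groupType) (X : completeNormedModType R).
Variables (pi : banach_module G X) (F : groupClosed G) (n : nat).

Definition res_cochain m (phi : cochain G X m) : cochain (subgroup F) X m :=
  fun g => phi (fun i => val (g i)).

Lemma res_coboundary m (phi : cochain G X m) :
  coboundary (res_module pi F) (res_cochain phi) =
  res_cochain (coboundary pi phi).
Proof.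
apply/funext => g; rewrite /coboundary /res_cochain /=; congr (_ - _).
apply: eq_bigr => i _; congr (_ *: phi _); apply/funext => j.
by rewrite /contract; case: ifP => // _; case: ifP.
Qed.

Lemma res_cocycle_subproof (z : cocycle pi n) :
  coboundary (res_module pi F) (res_cochain z) == 0.
Proof. by apply/eqP; rewrite res_coboundary (eqP (valP z)). Qed.

Definition res_cocycle (z : cocycle pi n) : cocycle (res_module pi F) n :=
  Cocycle (res_cocycle_subproof z).

(* Independent of the representative by [res_cohomologyE]. *)
Definition res_cohomology (c : reduced_cohomology pi n) :
    reduced_cohomology (res_module pi F) n :=
  \pi_(reduced_cohomology (res_module pi F) n) (res_cocycle (repr c)).

Lemma res_coboundaries (phi : cochain G X n) :
  coboundaries pi phi -> coboundaries (res_module pi F) (res_cochain phi).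
Proof.
case: n phi => [|m] phi; first by move=> ->.
by move=> [psi _ <-]; exists (res_cochain psi) => //; exact: res_coboundary.
Qed.

Lemma res_closed_coboundary (z : cocycle pi n) :
  z \in @closed_coboundary _ _ _ pi n ->
  res_cocycle z \in @closed_coboundary _ _ _ (res_module pi F) n.
Proof.
move=> /asboolP; rewrite closureEcvg => -[U PU [Uz UB]]; apply/asboolP.
rewrite closureEcvg; exists (@res_cochain n @ U).
  exact: fmap_proper_filter.
split=> [|A BA]; last by apply: UB => phi /res_coboundaries; exact: BA.
apply/ptws_cvgP => t.
exact: ((ptws_cvgP _ PU).1 Uz (fun i => val (t i))).
Qed.

Lemma res_cohomologyE (z : cocycle pi n) :
  res_cohomology (\pi_(reduced_cohomology pi n) z) =
  \pi_(reduced_cohomology (res_module pi F) n) (res_cocycle z).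
Proof.
apply/eqP; rewrite -Quotient.idealrBE.
set w := repr _.
have -> : res_cocycle w - res_cocycle z = res_cocycle (w - z).
  exact: val_inj.
by apply: res_closed_coboundary; rewrite Quotient.idealrBE reprK.
Qed.

End RestrictionMap.

Definition affine_isometric_action (R : realType) (G : groupType)
    (X : completeNormedModType R) (pi : banach_module G X)
    (alpha : G -> X -> X) : Prop :=
  exists phi : cocycle pi 1,
    forall g x, alpha g x = pi g x + cocycle_val phi (fun=> g).

Definition almost_fixed_points (R : realType) (G : groupType)
    (X : completeNormedModType R) (F : groupClosed G) (alpha : G -> X -> X) :=
  forall (E : set G) (eps : R), finite_set E -> E `<=` [set g | g \in F] ->
    0 < eps -> exists x : X, forall f, E f -> `|x - alpha f x| < eps.

(* Main.v *)
From HB Require Import structures.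
Require Import Defs.
From mathcomp Require Import all_boot all_order all_algebra.
From mathcomp Require Import all_classical all_reals all_analysis.
From mathcomp Require Import ring lra.

Set Implicit Arguments.
Unset Strict Implicit.
Unset Printing Implicit Defensive.

Import Order.TTheory GRing.Theory Num.Theory.
Import numFieldNormedType.Exports.
Local Open Scope classical_set_scope.
Local Open Scope ring_scope.

(** Averaging over conjugates kills reduced cohomology. Let [g] be an element
    of [FC F], with conjugates [g_1, .., g_k] under [F], and let [phi] be a
    cocycle of [G]. Conjugation by an element of [G] is homotopic to the
    identity on the bar complex, and the sum of the homotopies for [g_1, ..,
    g_k] is compatible with the action of [F], so on [F] the cocycle [phi]
    differs from its average [(pi g_1 phi + .. + pi g_k phi) / k] by a
    coboundary ([average_homotopic]). The operators [S] on [X] such that [phi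
    - S phi] is a coboundary on [F] and which commute with [F] are stable
    under composition and convex combinations; the convex semigroup generated
    by these averages therefore consists of such operators, all of norm at
    most one ([averaging_homotopic]). It remains to find, for finitely many
    vectors, an operator of the semigroup which makes all of them small: then
    [phi] is pointwise close to a coboundary on [F].

    A product of operators deals with finitely many vectors one after the
    other, so one vector [x] is enough ([averaging_small]). The closure [K]
    of the set of all [S x] is convex, bounded and invariant under the
    semigroup. Since closed bounded convex sets of a reflexive space have the
    finite intersection property ([reflexive_fip]), each operator of the
    semigroup has a fixed point in [K] ([contraction_fixed_point]). Apply
    this to the average over a finite union of conjugacy classes: a vector
    which is the average of finitely many of its translates under a group of
    isometries is equal to each of them ([mean_fixed]). Hence every finite
    subset of [FC F] fixes a point of [K], by compactness [FC F] fixes a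
    point of [K], and this point is [0] by hypothesis.

    [mean_fixed] is the core of the Ryll-Nardzewski fixed point theorem and
    is proved following Namioka and Asplund: the closed convex hull of the
    orbit of the vector has slices of arbitrarily small diameter
    ([small_slice]). Small slices come from Baire's theorem in the dual space
    ([dual_baire]) and from the fact that every functional attains its
    supremum over a closed bounded convex set of a reflexive space.
    Separation of points from convex sets rests on the Hahn-Banach theorem,
    obtained from minimal sublinear functionals ([hahn_banach]). *)

(** * Sublinear functionals and the Hahn-Banach theorem *)

(** Convexity in terms of the operations of the vector space. *)
Lemma convex_setP (R : numDomainType) (V : lmodType R) (A : set V) :
  @convex_set R V A <->
  forall s x y, 0 <= s -> s <= 1 -> A x -> A y -> A (s *: x + (1 - s) *: y).
Proof.
split=> [cA s x y s0 s1 Ax Ay|cA x y s /set_mem Ax /set_mem Ay].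
  have s01 : Itv.spec (@Itv.num_sem R) (Itv.Real `[0%Z, 1%Z]) s.
    by rewrite /Itv.num_sem/= in_itv/= s0 s1 realE s0.
  have := cA x y (Itv.mk s01) (mem_set Ax) (mem_set Ay).
  exact: set_mem.
apply/mem_set; exact: cA.
Qed.

Section HahnBanach.
Variables (R : realType) (V : lmodType R).
Implicit Types (p q : V -> R) (D : set V).

(** Subadditive and positively homogeneous, as in the Hahn-Banach theorem. *)
Definition sublinear p :=
  (forall u v, p (u + v) <= p u + p v) /\
  (forall t u, 0 <= t -> p (t *: u) = t * p u).

Lemma sublinear0 p : sublinear p -> p 0 = 0.
Proof. by move=> [_ /(_ 0 0 (lexx _))]; rewrite scale0r mul0r. Qed.

Lemma sublinearN p v : sublinear p -> - p (- v) <= p v.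
Proof.
move=> sp; have := sp.1 v (- v).
by rewrite subrr sublinear0// => ?; rewrite lerNl; lra.
Qed.

(** When [D] is nonempty and convex and [q] is at least [d] on [D], this is
    the largest sublinear functional which is below [q] and at most [- d] on
    [- D]. *)
Definition mazur_orlicz q D d v : R :=
  inf [set q (v + t *: w) - t * d | t in [set t | 0 <= t] & w in D].

Section MazurOrlicz.
Variables (q : V -> R) (D : set V) (d : R).
Hypotheses (sq : sublinear q) (D0 : D !=set0) (cD : @convex_set R V D).
Hypothesis qD : forall w, D w -> d <= q w.

Let S v := [set q (v + t *: w) - t * d | t in [set t | 0 <= t] & w in D].

Let S0 v : S v !=set0.
Proof.
have [w Dw] := D0; exists (q (v + 0 *: w) - 0 * d).
by exists 0 => //=; exists w.
Qed.

Let lbS v : lbound (S v) (- q (- v)).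
Proof.
move=> _ [t /= t0 [w Dw <-]].
have := sq.1 (v + t *: w) (- v); rewrite addrAC subrr add0r sq.2//.
have := ler_wpM2l t0 (qD Dw); lra.
Qed.

Let infS v t w : 0 <= t -> D w ->
  mazur_orlicz q D d v <= q (v + t *: w) - t * d.
Proof.
move=> t0 Dw; apply: ge_inf; first by exists (- q (- v)); exact: lbS.
by exists t => //; exists w.
Qed.

Lemma mazur_orlicz_le v : mazur_orlicz q D d v <= q v.
Proof.
have [w Dw] := D0; have := infS v (lexx 0) Dw.
by rewrite scale0r addr0 mul0r subr0.
Qed.

Lemma mazur_orliczN w : D w -> mazur_orlicz q D d (- w) <= - d.
Proof.
move=> Dw; have := infS (- w) ler01 Dw.
by rewrite scale1r addNr sublinear0// mul1r sub0r.
Qed.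

Lemma mazur_orlicz_sublinear : sublinear (mazur_orlicz q D d).
Proof.
split=> [u v|t u].
  rewrite -lerBlDr; apply: (lb_le_inf (S0 _)) => _ [s /= s0 [w Dw <-]].
  rewrite lerBlDl -lerBlDr; apply: (lb_le_inf (S0 _)) => _ [r /= r0 [x Dx <-]].
  rewrite lerBlDr.
  have [sr|sr] := eqVneq (s + r) 0.
    have [-> ->] : s = 0 /\ r = 0 by split; lra.
    apply: le_trans (mazur_orlicz_le _) _.
    by rewrite !scale0r !addr0 !mul0r !subr0 addrC; exact: sq.1.
  (* [s w + r x] is [s + r] times a convex combination of [w] and [x]. *)
  have sr0 : 0 < s + r by rewrite lt_def sr addr_ge0.
  have e : 1 - s / (s + r) = r / (s + r) by field.
  have sr1 : s / (s + r) <= 1 by rewrite ler_pdivrMr// mul1r lerDl.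
  have := infS (u + v) (ltW sr0)
    ((convex_setP _).1 cD _ _ _ (divr_ge0 s0 (ltW sr0)) sr1 Dw Dx).
  move=> /le_trans; apply.
  rewrite e scalerDr !scalerA ![(s + r) * _]mulrC !divfK// addrACA.
  have := sq.1 (u + s *: w) (v + r *: x); lra.
rewrite le_eqVlt => /predU1P[<-|t0].
  rewrite scale0r mul0r; apply/eqP; rewrite eq_le; apply/andP; split.
    by rewrite -(sublinear0 sq) mazur_orlicz_le.
  by apply: (lb_le_inf (S0 _)) => x /lbS; rewrite oppr0 sublinear0// oppr0.
have H a v : 0 < a -> a * mazur_orlicz q D d v <= mazur_orlicz q D d (a *: v).
  move=> a0; apply: (lb_le_inf (S0 _)) => _ [s /= s0 [w Dw <-]].
  have := infS v (divr_ge0 s0 (ltW a0)) Dw.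
  rewrite -(ler_pM2l a0) mulrBr -sq.2 ?(ltW a0)// scalerDr scalerA.
  by rewrite [a * (_ * d)]mulrA !(mulrC a) divfK// gt_eqF.
apply/eqP; rewrite eq_le H// andbT -ler_pdivrMl//.
have := H t^-1 (t *: u); rewrite invr_gt0 => /(_ t0) /le_trans; apply.
by rewrite scalerA mulVf ?scale1r// gt_eqF.
Qed.

End MazurOrlicz.

(** A minimal sublinear functional is linear, so a linear functional below a
    sublinear one is found by minimality among sublinear functionals, without
    extending anything from a subspace. *)
Lemma hahn_banach p : sublinear p ->
  exists2 f : V -> R^o, linear f & forall v, f v <= p v.
Proof.
move=> sp.
pose T := {q : V -> R | sublinear q /\ forall v, q v <= p v}.
pose le (s t : T) := `[< forall v, sval t v <= sval s v >].
have [||||[q [sq qp]] qmin] := @Zorn T le.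
- by move=> t; apply/asboolP.
- move=> r s t /asboolP rs /asboolP st; apply/asboolP => v.
  exact: le_trans (rs v).
- move=> [s hs] [t ht] /asboolP /= st /asboolP /= ts; apply: eq_exist => //.
  by apply/funext => v; apply/eqP; rewrite eq_le ts st.
- move=> A tA; have [[a0 Aa0]|A0] := pselect (A !=set0); last first.
    exists (exist _ p (conj sp (fun=> lexx _))) => s As.
    by case: A0; exists s.
  pose S v := [set sval a v | a in A].
  have S0 v : S v !=set0 by exists (sval a0 v), a0.
  have lbS v : lbound (S v) (- p (- v)).
    move=> _ [[q [sq qp]] _ <-] /=.
    by apply: le_trans (sublinearN v sq); rewrite lerN2.
  have infS v a : A a -> inf (S v) <= sval a v.
    by move=> Aa; apply: ge_inf; [exists (- p (- v)); exact: lbS|exists a].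
  pose q v := inf (S v).
  have sq : sublinear q.
    split=> [u v|t u t0].
      rewrite -lerBlDr; apply: (lb_le_inf (S0 _)) => _ [a Aa <-].
      rewrite lerBlDl -lerBlDr; apply: (lb_le_inf (S0 _)) => _ [b Ab <-].
      rewrite lerBlDr.
      case: (tA a b Aa Ab) => /asboolP ab.
        apply: le_trans (infS _ _ Ab) _; apply: le_trans ((svalP b).1.1 _ _) _.
        by rewrite addrC lerD2l; exact: ab.
      apply: le_trans (infS _ _ Aa) _; apply: le_trans ((svalP a).1.1 _ _) _.
      by rewrite addrC lerD2r; exact: ab.
    have H a v : 0 <= a -> a * q v <= q (a *: v).
      move=> a_0; apply: (lb_le_inf (S0 _)) => _ [b Ab <-].
      by rewrite (svalP b).1.2// ler_wpM2l// infS.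
    apply/eqP; rewrite eq_le H// andbT.
    move: t0; rewrite [0 <= t]le_eqVlt => /predU1P[<-|t0].
      rewrite scale0r mul0r; apply: le_trans (infS 0 _ Aa0) _.
      by rewrite sublinear0//; exact: (svalP a0).1.
    rewrite -ler_pdivrMl//; have := H t^-1 (t *: u).
    rewrite invr_ge0 => /(_ (ltW t0)) /le_trans; apply.
    by rewrite scalerA mulVf ?scale1r// gt_eqF.
  have qp v : q v <= p v.
    by apply: le_trans (infS v _ Aa0) _; exact: (svalP a0).2.
  by exists (exist _ q (conj sq qp)) => s As; apply/asboolP => v; exact: infS.
(* By minimality [q] is its own [mazur_orlicz] modification for the singleton
   [w] and the value [q w], which gives the missing inequality. *)
have add u w : q (u + w) = q u + q w.
  apply/eqP; rewrite eq_le sq.1/=.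
  have cw : @convex_set R V [set w].
    apply/convex_setP => s x y _ _ -> ->.
    by rewrite -scalerDl addrC subrK scale1r.
  have w0 : [set w] !=set0 by exists w.
  have qw x : [set w] x -> q w <= q x by move=> ->.
  pose r := mazur_orlicz q [set w] (q w).
  have rq v : r v <= q v by exact: mazur_orlicz_le.
  have sr : sublinear r by exact: mazur_orlicz_sublinear.
  have rp v : r v <= p v by exact: le_trans (rq v) (qp v).
  have /(congr1 sval)/= E :=
    qmin (exist _ r (conj sr rp)) (introT (asboolP _) rq).
  rewrite -[q u](congr1 (@^~ u) E) -lerBrDr; apply: ge_inf.
    exists (- q (- u)) => _ [t /= t0 [_ -> <-]].
    have := sq.1 (u + t *: w) (- u); rewrite addrAC subrr add0r sq.2//; lra.
  by exists 1; rewrite /= ?ler01//; exists w => //; rewrite scale1r mul1r.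
have opp u : q (- u) = - q u.
  by apply/eqP; rewrite -addr_eq0 -add addNr sublinear0.
exists q => // a u v; rewrite add; congr (_ + _).
have [a0|/ltW a0] := leP 0 a; first by rewrite sq.2.
by rewrite -[a]opprK scaleNr opp sq.2 ?oppr_ge0// [RHS]mulNr.
Qed.

(** The Mazur-Orlicz theorem. *)
Corollary mazur_orlicz_dominated p D d :
  sublinear p -> D !=set0 -> @convex_set R V D ->
  (forall w, D w -> d <= p w) ->
  exists f : V -> R^o, [/\ linear f, forall v, f v <= p v
                         & forall w, D w -> d <= f w].
Proof.
move=> sp D0 cD pD.
have [f lf fp] := hahn_banach (mazur_orlicz_sublinear sp D0 cD pD).
exists f; split=> // [v|w Dw]; first exact/(le_trans (fp v))/mazur_orlicz_le.
have fN : f (- w) = - f w.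
  have f0 : f 0 = 0.
    by have := lf (-1) 0 0; rewrite scaler0 addr0 scaleN1r addNr.
  by have := lf (-1) w 0; rewrite f0 !addr0 !scaleN1r.
by rewrite -lerN2 -fN (le_trans (fp _)) ?mazur_orliczN.
Qed.

End HahnBanach.

(** * Weak compactness in reflexive spaces *)

Section LinearFunctional.
Variables (R : pzRingType) (V : lmodType R) (W : lmodType R) (f : V -> W).
Hypothesis lf : linear f.

Lemma lin0 : f 0 = 0.
Proof. by have := lf (-1) 0 0; rewrite scaler0 addr0 scaleN1r addNr. Qed.

Lemma linD u v : f (u + v) = f u + f v.
Proof. by have := lf 1 u v; rewrite !scale1r. Qed.

Lemma linZ a u : f (a *: u) = a *: f u.
Proof. by have := lf a u 0; rewrite lin0 !addr0. Qed.

Lemma linN u : f (- u) = - f u.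
Proof. by rewrite -scaleN1r linZ scaleN1r. Qed.

Lemma linB u v : f (u - v) = f u - f v.
Proof. by rewrite linD linN. Qed.

End LinearFunctional.

Lemma regularZ (R : pzRingType) (a : R) (b : R^o) : a *: b = a * b.
Proof. by []. Qed.

Section Dual.
Variables (R : realType) (X : normedModType R).
Implicit Types (f : X -> R^o) (x v : X) (C : set X).

Lemma dual_spaceP f : linear f ->
  dual_space f <-> exists M : R, forall v, `|f v| <= M * `|v|.
Proof.
move=> lf; pose F := GRing.isLinear.Build R X R^o _ f lf.
pose f' : {linear X -> R^o} := HB.pack f F.
split=> [[_ cf]|[M fM]].
  have /linear_boundedP/pinfty_ex_gt0 [M _ fM] : bounded_near f' (nbhs (0 : X)).
    by apply: continuous_linear_bounded; exact: cf.
  by exists M.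
split=> //; apply: (@bounded_linear_continuous _ _ _ f'); apply/linear_boundedP.
near=> r => v; apply: le_trans (fM v) _; by apply: ler_wpM2r.
Unshelve. all: by end_near. Qed.

Lemma dual_le_norm f : linear f -> (forall v, f v <= `|v|) ->
  forall v, `|f v| <= `|v|.
Proof.
move=> lf fn v; rewrite ler_norml fn andbT lerNl.
by have := fn (- v); rewrite linN// normrN.
Qed.

Lemma dual_norm_le f : dual_space f -> forall v, `|f v| <= dual_norm f * `|v|.
Proof.
move=> df v; have lf := df.1; have [M fM] := (dual_spaceP lf).1 df.
have [->|v0] := eqVneq v 0; first by rewrite lin0// !normr0 mulr0.
have nv : 0 < `|v| by rewrite normr_gt0.
rewrite -ler_pdivrMr//; apply: ub_le_sup.
  exists `|M| => _ [u /= u1 <-]; apply: le_trans (fM u) _.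
  apply: le_trans (ler_norm _) _; rewrite normrM normr_id.
  by rewrite ler_piMr.
exists (`|v|^-1 *: v) => /=.
  by rewrite normrZ normfV normr_id mulVf// gt_eqF.
rewrite linZ// regularZ normrM normfV normr_id mulrC //.
Qed.

Lemma dual_norm_ge0 f : 0 <= dual_norm f.
Proof.
have [[E0 [M ubM]]|nE] :=
  pselect (has_sup [set `|f x| | x in [set x : X | `|x| <= 1]]).
  have [a Ea] := E0; apply: le_trans (ub_le_sup _ Ea); last by exists M.
  by have [v _ <-] := Ea; exact: normr_ge0.
by rewrite /dual_norm sup_out.
Qed.

(** A point at distance at least [d] from a nonempty convex set is separated
    from it by a functional of norm at most one, with a gap of at least [d]. *)
Lemma separation C x d : C !=set0 -> @convex_set R X C ->
  (forall c, C c -> d <= `|x - c|) ->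
  exists f, [/\ linear f, forall v, `|f v| <= `|v|
              & forall c, C c -> f c <= f x - d].
Proof.
move=> C0 cC Cd.
have snorm : sublinear (fun v : X => `|v|).
  split=> [u v|t u t0]; first exact: ler_normD.
  by rewrite normrZ ger0_norm.
pose D := [set x - c | c in C].
have D0 : D !=set0 by have [c Cc] := C0; exists (x - c), c.
have cD : @convex_set R X D.
  apply/convex_setP => s _ _ s0 s1 [a Ca <-] [b Cb <-].
  exists (s *: a + (1 - s) *: b); first exact: ((convex_setP _).1 cC).
  rewrite !scalerBr addrACA -scalerDl addrC.
  by rewrite [s + _]addrC subrK scale1r opprD [RHS]addrC.
have Dd w : D w -> d <= `|w| by move=> [c Cc <-]; exact: Cd.
have [f [lf fn fd]] := mazur_orlicz_dominated snorm D0 cD Dd.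
exists f; split=> //; first exact: dual_le_norm.
move=> c Cc; have := fd (x - c) (ex_intro2 _ _ c Cc erefl).
by rewrite linB// => ?; rewrite lerBrDl -lerBrDr.
Qed.

Lemma closed_dist_gt0 C x : closed C -> ~ C x ->
  exists2 d : R, 0 < d & forall c, C c -> d <= `|x - c|.
Proof.
move=> cC Cx; have /nbhs_ballP[d /= d0 dC] : nbhs x (~` C).
  by apply: open_nbhs_nbhs; split=> //; exact: closed_openC.
exists d => // c Cc; rewrite leNgt; apply/negP => xc.
by apply: (dC c) => //; rewrite -ball_normE.
Qed.

(** In a reflexive space, the closed convex members of a filter which
    contains a bounded set have a common point. Limits of functionals along
    an ultrafilter finer than [F] define an element of the bidual, hence a
    point, and this point cannot be separated from a closed convex member of
    [F]. *)
Lemma reflexive_filter (F : set_system X) (M : R) :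
  reflexive_space X -> ProperFilter F -> F [set x | `|x| <= M] ->
  exists x, forall C, F C -> closed C -> @convex_set R X C -> C x.
Proof.
move=> refl FF FM; have [U [UU FU]] := ultraFilterLemma FF.
have UM := FU _ FM.
have Ucvg f : dual_space f -> cvg (f @ U).
  move=> df; have fUM : (f @ U) [set` `[- (dual_norm f * M), dual_norm f * M]].
    apply: (@filterS _ U _ [set x | `|x| <= M]) => //= x xM.
    rewrite /preimage/= in_itv/= -ler_norml.
    apply: le_trans (dual_norm_le df x) _.
    by rewrite ler_wpM2l// dual_norm_ge0.
  have [a [_ /= ca]] := @segment_compact _ _ _ (f @ U) _ fUM.
  apply/cvg_ex; exists a; apply/cvgrPdist_lt => e e0.
  have [//|nU] := in_ultra_setVsetC [set x | `|a - f x| < e] UU.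
  have [b [/= ab]] :=
    ca [set b | ~ `|a - b| < e] (ball a e) nU (nbhsx_ballx _ _ e0).
  by rewrite -ball_normE.
pose Phi f : R := lim (f @ U).
have PhiE f : dual_space f -> f @ U --> Phi f by exact: Ucvg.
have [|x xP] := refl Phi.
  split.
    move=> a f g df dg; apply: cvg_lim => //.
    by apply: cvgD; [apply: cvgMr; exact: PhiE|exact: PhiE].
  exists M => f df; apply: cvgr_to_le (cvg_norm (PhiE f df)) _.
  apply: filterS UM => x /= xM; apply: le_trans (dual_norm_le df x) _.
  by rewrite mulrC ler_wpM2r// dual_norm_ge0.
exists x => C FC cC cvC; apply: contrapT => Cx.
have [d d0 dC] := closed_dist_gt0 cC Cx.
have C0 : C !=set0 by exact: filter_ex FC.
have [f [lf fn fC]] := separation C0 cvC dC.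
have df : dual_space f by apply/dual_spaceP => //; exists 1 => v; rewrite mul1r.
have : Phi f <= f x - d.
  apply: cvgr_to_le (PhiE f df) _; apply: filterS (FU _ FC).
  exact: fC.
rewrite (xP _ df); lra.
Qed.
End Dual.

(** * Closed bounded convex sets *)

Section Convexity.
Variables (R : realType) (X : normedModType R).
Implicit Types (C K : set X).

Lemma closed_preimage (Y : topologicalType) (f : X -> Y) (A : set Y) :
  continuous f -> closed A -> closed [set x | A (f x)].
Proof. by move=> cf cA; apply: preimage_closed => // x _; exact: cf. Qed.

Lemma closed_halfspace (f : X -> R^o) (a : R) :
  dual_space f -> closed [set x | f x <= a].
Proof. by move=> [_ cf]; exact: closed_preimage cf (@closed_le _ a). Qed.

Lemma convex_halfspace (f : X -> R^o) (a : R) :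
  linear f -> @convex_set R X [set x | f x <= a].
Proof.
move=> lf; apply/convex_setP => s x y s0 s1 /= fx fy.
rewrite (linD lf) !(linZ lf) !regularZ.
have := ler_wpM2l s0 fx; have s1' : 0 <= 1 - s by lra.
have := ler_wpM2l s1' fy; lra.
Qed.

Lemma convex_setI C K :
  @convex_set R X C -> @convex_set R X K -> @convex_set R X (C `&` K).
Proof.
move=> /convex_setP cC /convex_setP cK; apply/convex_setP => s x y s0 s1.
by move=> [Cx Kx] [Cy Ky]; split; [exact: cC|exact: cK].
Qed.

Lemma convex_norm_le (Y : normedModType R) (T : X -> Y) (b : Y) (r : R) :
  linear T -> @convex_set R X [set x | `|T x - b| <= r].
Proof.
move=> lT; apply/convex_setP => s x y s0 s1 /= Tx Ty.
have s1' : 0 <= 1 - s by lra.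
have -> : T (s *: x + (1 - s) *: y) - b = s *: (T x - b) + (1 - s) *: (T y - b).
  rewrite (linD lT) !(linZ lT) !scalerBr addrACA -opprD -scalerDl.
  by rewrite [s + _]addrC subrK scale1r.
apply: le_trans (ler_normD _ _) _; rewrite !normrZ !ger0_norm//.
have := ler_wpM2l s0 Tx; have := ler_wpM2l s1' Ty; lra.
Qed.

Lemma convex_ball_le (b : X) (r : R) : @convex_set R X [set x | `|x - b| <= r].
Proof. exact: (@convex_norm_le X id). Qed.

Lemma closed_norm_le (Y : normedModType R) (T : X -> Y) (b : Y) (r : R) :
  continuous T -> closed [set x | `|T x - b| <= r].
Proof.
move=> cT.
apply: (@closed_preimage _ (fun x => `|T x - b|) _ _ (@closed_le _ r)).
move=> x; apply: cvg_norm; apply: cvgB; [exact: cT|exact: cvg_cst].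
Qed.

Lemma closed_ball_le (b : X) (r : R) : closed [set x | `|x - b| <= r].
Proof. by apply: (@closed_norm_le X id) => x; exact: cvg_id. Qed.

(** The finite intersection property for closed bounded convex sets. *)
Lemma reflexive_fip (I : Type) (D : set I) (B : I -> set X) (M : R) :
  reflexive_space X -> D !=set0 ->
  (forall i j, D i -> D j -> exists2 k, D k & B k `<=` B i `&` B j) ->
  (forall i, D i -> [/\ B i !=set0, closed (B i), @convex_set R X (B i)
                      & B i `<=` [set x | `|x| <= M]]) ->
  exists x, forall i, D i -> B i x.
Proof.
move=> refl [i0 Di0] dir BP.
have FF : ProperFilter (filter_from D B).
  apply: filter_from_proper.
    by apply: filter_from_filter => //; exists i0.
  by move=> i /BP[].
have [|x xP] := reflexive_filter (M := M) refl FF.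
  by exists i0 => //; have [] := BP _ Di0.
by exists x => i Di; have [_ ? ? _] := BP _ Di; apply: xP => //; exists i.
Qed.

Lemma attains_sup (f : X -> R^o) K (M : R) :
  reflexive_space X -> dual_space f ->
  K !=set0 -> closed K -> @convex_set R X K -> K `<=` [set x | `|x| <= M] ->
  exists2 x, K x & forall y, K y -> f y <= f x.
Proof.
move=> refl df K0 cK cvK KM.
have ubf : has_ubound (f @` K).
  exists (dual_norm f * M) => _ [x Kx <-]; apply: le_trans (ler_norm _) _.
  apply: le_trans (dual_norm_le df x) _.
  by apply: ler_wpM2l; [exact: dual_norm_ge0|exact: KM].
have supf : has_sup (f @` K) by split=> //; have [x Kx] := K0; exists (f x), x.
pose B e := K `&` [set x | - f x <= e - sup (f @` K)].
have dNf : dual_space (- f).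
  apply/dual_spaceP; last by have [M' fM'] := (dual_spaceP df.1).1 df;
    exists M' => v; rewrite normrN.
  by move=> a u v; rewrite !fctE df.1 opprD scalerN.
have [||e e0|x xB] := @reflexive_fip R [set e | 0 < e] B M refl.
- by exists 1 => /=.
- move=> i j i0 j0; exists (Num.min i j); first by rewrite /= lt_min i0.
  move=> x [Kx] /= xe; split; split=> //=; apply: le_trans xe _; rewrite lerD2r.
    by rewrite ge_min lexx.
  by rewrite ge_min lexx orbT.
- split.
  + have [_ [x Kx <-] fx] := sup_adherent e0 supf.
    by exists x; split=> //=; rewrite lerNl opprB ltW.
  + by apply: closedI => //; exact: (@closed_halfspace (- f)).
  + by apply: convex_setI => //; exact: (@convex_halfspace (- f)) dNf.1.
  + by move=> x [/KM].
have [Kx _] := xB 1 ltr01.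
exists x => // y Ky; apply: le_trans (ub_le_sup ubf _) _; first by exists y.
apply/ler_addgt0Pr => e e0; have [_ /=] := xB e e0; lra.
Qed.

End Convexity.

(** * Slices of small diameter *)

Section Dentability.
Variables (R : realType) (X : normedModType R).
Implicit Types (f g : X -> R^o) (K : set X).

(** The functionals at distance at most [r] from [f], written without the dual
    norm. *)
Definition dual_ball f (r : R) : set (X -> R^o) :=
  [set g | dual_space g /\ forall v, `|g v - f v| <= r * `|v|].

Lemma dual_ball_le f r s : r <= s -> dual_ball f r `<=` dual_ball f s.
Proof.
move=> rs g [dg gf]; split=> // v; apply: le_trans (gf v) _.
exact: ler_wpM2r.
Qed.

Lemma dual_ball_trans f g r s :
  dual_ball f r g -> dual_ball g s `<=` dual_ball f (s + r).
Proof.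
move=> [_ gf] h [dh hg]; split=> // v; rewrite mulrDl.
have -> : h v - f v = (h v - g v) + (g v - f v) by rewrite addrA subrK.
by apply: le_trans (ler_normD _ _) _; exact: lerD.
Qed.

(** The dual space is a Baire space, being complete: the pointwise limit of the
    centers of nested balls, with radii tending to [0], belongs to all the
    balls. *)
Lemma dual_baire (P : nat -> set (X -> R^o)) :
  (forall n f r, dual_space f -> 0 < r ->
    exists g, dual_ball f r g /\ exists2 s, 0 < s & dual_ball g s `<=` P n) ->
  exists2 f, dual_space f & forall n, P n f.
Proof.
move=> dP.
pose T := {p : (X -> R^o) * R | dual_space p.1 /\ 0 < p.2}.
pose B (p : T) := dual_ball (sval p).1 (sval p).2.
pose next n p q := [/\ B q `<=` B p, B q `<=` P n & (sval q).2 <= n.+1%:R^-1].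
have step (n : nat) (p : T) : exists q : T, next n p q.
  case: p => -[f r] /= [df r0].
  have r20 : 0 < r / 2 by lra.
  have [g [gf [s s0 gP]]] := dP n f (r / 2) df r20.
  pose t := Num.min (r / 2) (Num.min s n.+1%:R^-1).
  have t0 : 0 < t by rewrite !lt_min r20 s0 invr_gt0 ltr0n.
  exists (exist _ (g, t) (conj gf.1 t0)); split=> /=.
  - move=> h /(dual_ball_trans gf); apply: dual_ball_le.
    have : t <= r / 2 by rewrite ge_min lexx.
    rewrite /=; lra.
  - by apply: subset_trans gP; apply: dual_ball_le; rewrite !ge_min lexx !orbT.
  - by rewrite !ge_min lexx !orbT.
have [F FP] : exists F : nat -> T -> T, forall n p, next n p (F n p).
  have /choice[F FP] : forall np : nat * T, exists q : T, next np.1 np.2 q.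
    by move=> [n p]; exact: step.
  by exists (fun n p => F (n, p)) => n p; exact: (FP (n, p)).
have d0 : dual_space ((fun=> 0) : X -> R^o).
  have l0 : linear ((fun=> 0) : X -> R^o).
    by move=> a u v; rewrite scaler0 addr0.
  by apply/(dual_spaceP l0); exists 0 => v; rewrite normr0 mul0r.
pose u : nat -> T :=
  nat_rect (fun=> T) (exist _ (fun=> 0, 1) (conj d0 ltr01)) F.
pose h n := (sval (u n)).1; pose r n := (sval (u n)).2.
have hd n : dual_space (h n) by exact: (svalP (u n)).1.
have r0 n : 0 < r n by exact: (svalP (u n)).2.
have rn n : r n.+1 <= n.+1%:R^-1 by have [] := FP n (u n).
have hP n : dual_ball (h n.+1) (r n.+1) `<=` P n by have [] := FP n (u n).
have sub n m : (n <= m)%N -> dual_ball (h m) (r m) `<=` dual_ball (h n) (r n).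
  elim: m => [|m IHm]; first by rewrite leqn0 => /eqP ->.
  rewrite leq_eqVlt => /predU1P[->//|/IHm]; apply: subset_trans.
  by have [] := FP m (u m).
have hnm n m v : (n <= m)%N -> `|h m v - h n v| <= r n * `|v|.
  move=> /sub /(_ (h m))[|_]; last exact.
  by split=> // w; rewrite subrr normr0 mulr_ge0// ltW.
have hc v : cvg (h n v @[n --> \oo]).
  apply/cauchy_cvgP/cauchy_exP => e e0.
  have [N Ne] : exists N, r N * `|v| < e.
    have [N _ /(_ _ (leqnn _)) NP] := nbhs_infty_ger (`|v| / e + 1).
    exists N.+1; apply: le_lt_trans (ler_wpM2r (normr_ge0 v) (rn N)) _.
    rewrite mulrC ltr_pdivrMr// mulrC -ltr_pdivrMr//.
    apply: lt_le_trans (_ : N%:R <= _); last by rewrite ler_nat.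
    move: NP => /=; lra.
  exists (h N v); exists N => // m /= Nm.
  by rewrite -ball_normE /= distrC (le_lt_trans _ Ne)// hnm.
pose f v := lim (h n v @[n --> \oo]).
have fc v : h n v @[n --> \oo] --> f v by exact: hc.
have fh n v : `|f v - h n v| <= r n * `|v|.
  apply: cvgr_to_le (cvg_norm (cvgB (fc v) (cvg_cst (h n v)))) _.
  by exists n => // m /= nm; exact: hnm.
have lf : linear f.
  move=> a x y; apply: cvg_lim => //.
  rewrite (_ : (fun n => h n _) = (fun n => a *: h n x + h n y)); last first.
    by apply/funext => n; exact: (hd n).1.
  by apply: cvgD; [apply: cvgMr; exact: fc|exact: fc].
have df : dual_space f.
  apply/dual_spaceP => //; have [M hM] := (dual_spaceP (hd 0%N).1).1 (hd 0%N).
  exists (r 0%N + M) => v; rewrite mulrDl -[f v](subrK (h 0%N v)).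
  by apply: le_trans (ler_normD _ _) _; exact: lerD.
by exists f => // n; apply: (hP n); split.
Qed.

(** A bounded closed convex subset of a separable reflexive space has slices
    of arbitrarily small diameter. Every functional attains its supremum over
    [K], at a point close to one of countably many points [x_ n]. By Baire's
    theorem one [n] works for all functionals in some ball around [f];
    perturbing [f] by a functional which separates a point of [K] from the
    points of [K] close to [x_ n] shows that the points of a thin slice of
    [K] given by [f] are close to [x_ n]. *)
Lemma small_slice K (M e : R) :
  separable_space X -> reflexive_space X ->
  K !=set0 -> closed K -> @convex_set R X K -> K `<=` [set x | `|x| <= M] ->
  0 < e ->
  exists f c, [/\ dual_space f, exists2 x, K x & c < f x
    & forall x y, K x -> K y -> c < f x -> c < f y -> `|x - y| < e].
Proof.
move=> [D /countable_injP[idx idx_inj] denseD] refl K0 cK cvK KM e0.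
pose x_ n := xget 0 [set d | D d /\ idx d = n].
have x_D d : D d -> x_ (idx d) = d.
  move=> Dd; apply: xget_unique => // d' [Dd' /idx_inj].
  by apply; rewrite inE.
have x_near x : exists n, `|x - x_ n| <= e / 8.
  have [||y [xy Dy]] := denseD (ball x (e / 8)).
  - by exists x; apply: ballxx; lra.
  - exact: ball_open.
  by exists (idx y); rewrite x_D// ltW//; move: xy; rewrite -ball_normE.
(* [P n f]: the supremum of [f] over the points of [K] close to [x_ n] is less
   than its supremum over [K]. *)
pose P n : set (X -> R^o) := [set f | exists x eta, [/\ K x, 0 < eta &
  forall y, K y -> `|y - x_ n| <= e / 8 -> f y + eta <= f x]].
have [n [f [r [df r0 fr]]]] : exists n f r, [/\ dual_space f, 0 < r &
    forall g, dual_ball f r g -> ~ P n g].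
  apply: contrapT => nP; have [|f df fP] := @dual_baire P.
    move=> n f r df r0.
    have [g [gf Pg]] : exists g, dual_ball f r g /\ P n g.
      apply: contrapT => ng; apply: nP; exists n, f, r; split=> // g gf Pg.
      by apply: ng; exists g.
    exists g; split=> //; have [x [eta [Kx eta0 xP]]] := Pg.
    have M0 : 0 <= M by apply: le_trans (KM _ Kx); exact: normr_ge0.
    exists (eta / (4 * (M + 1))); first by apply: divr_gt0 => //; lra.
    move=> h [dh hg]; exists x, (eta / 2); split=> //; first by lra.
    have hK z : K z -> `|h z - g z| <= eta / 4.
      move=> Kz; apply: le_trans (hg z) _.
      have -> : eta / 4 = eta / (4 * (M + 1)) * (M + 1) by field; lra.
      apply: ler_wpM2l; first by apply: divr_ge0; lra.
      by have := KM _ Kz; rewrite /=; lra.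
    move=> y Ky yx; have := xP y Ky yx.
    have := hK x Kx; have := hK y Ky.
    rewrite !ler_norml => /andP[? ?] /andP[? ?].
    lra.
  have [x Kx xmax] := attains_sup refl df K0 cK cvK KM.
  have [n xn] := x_near x; have [y [eta [Ky eta0 yP]]] := fP n.
  have := yP x Kx xn; have := xmax y Ky; lra.
have approx g x eta : dual_ball f r g -> K x -> 0 < eta ->
    exists y, [/\ K y, `|y - x_ n| <= e / 8 & g x < g y + eta].
  move=> gf Kx eta0; apply: contrapT => nex; apply: (fr g gf).
  exists x, eta; split=> // y Ky yn; rewrite leNgt; apply/negP => gxy.
  by apply: nex; exists y.
have [x0 Kx0 x0max] := attains_sup refl df K0 cK cvK KM.
(* Moving [f] by [r] times a functional with a gap [e / 8] gains [r * e / 8],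
   which must exceed the thickness of the slice plus the error in [approx]. *)
pose eta := r * e / 16.
have eta0 : 0 < eta by apply: divr_gt0 => //; exact: mulr_gt0.
exists f, (f x0 - eta); split=> //; first by exists x0 => //; lra.
have near x : K x -> f x0 - eta < f x -> `|x - x_ n| < e / 4.
  move=> Kx fx.
  have [y [Ky yn xy]] :
      exists y, [/\ K y, `|y - x_ n| <= e / 8 & `|x - y| < e / 8].
    apply: contrapT => nex.
    pose Kn := K `&` [set y | `|y - x_ n| <= e / 8].
    have Kn0 : Kn !=set0.
      have [|y [Ky yn _]] := @approx f x 1 _ Kx ltr01; last by exists y.
      by split=> // v; rewrite subrr normr0 mulr_ge0// ltW.
    have cKn : @convex_set R X Kn.
      by apply: convex_setI => //; exact: convex_ball_le.
    have Knd y : Kn y -> e / 8 <= `|x - y|.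
      by move=> [Ky yn]; rewrite leNgt; apply/negP => xy; apply: nex; exists y.
    have [w [lw wn wK]] := separation Kn0 cKn Knd.
    pose g : X -> R^o := f + r *: w.
    have gE v : g v = f v + r * w v by [].
    have dg : dual_space g.
      apply/dual_spaceP.
        move=> a u v; rewrite !gE df.1 lw !regularZ; ring.
      have [M' fM'] := (dual_spaceP df.1).1 df; exists (M' + r) => v.
      rewrite gE mulrDl; apply: le_trans (ler_normD _ _) _; apply: lerD => //.
      by rewrite normrM gtr0_norm// ler_pM2l.
    have [|y [Ky yn]] := @approx g x eta _ Kx eta0.
      split=> // v; rewrite gE addrAC subrr add0r normrM gtr0_norm//.
      by rewrite ler_pM2l.
    rewrite !gE; have := ler_wpM2l (ltW r0) (wK y (conj Ky yn)).
    have := x0max y Ky; rewrite /eta in fx *; lra.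
  have -> : x - x_ n = (x - y) + (y - x_ n) by rewrite addrA subrK.
  apply: le_lt_trans (ler_normD _ _) _; lra.
move=> x y Kx Ky /(near _ Kx) xn /(near _ Ky); rewrite distrC => yn.
have -> : x - y = (x - x_ n) + (x_ n - y) by rewrite addrA subrK.
by apply: le_lt_trans (ler_normD _ _) _; lra.
Qed.

End Dentability.

(** * The conjugation homotopy *)

Section ListCochains.
Variables (G : groupType) (V : zmodType).
Implicit Types (phi psi : seq G -> V) (g f : G) (s t : seq G).

(** [phi] with its first entry multiplied by [f] on the left; the value at the
    empty list is the one which makes the recursion for [bar_diff] uniform. *)
Definition mul_head f phi s :=
  if s is h :: t then phi ((f * h)%g :: t) else phi [::].

(** The part of the differential of the bar complex which does not involve the
    action of the group. At [(g_1, .., g_n)] with [n > 0] it is the sum over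
    [1 <= i < n] of [(-1)^i phi (.., g_i g_(i+1), ..)] plus
    [(-1)^n phi (g_1, .., g_(n-1))]; the recursion on lists peels off [g_1]. *)
Fixpoint bar_diff phi s : V :=
  if s is g :: t then - mul_head g phi t - bar_diff (fun u => phi (g :: u)) t
  else 0.

(** The homotopy between the identity and conjugation by [g]. At [(f_1, ..,
    f_n)] it is the alternating sum over [0 <= j <= n] of [(-1)^j phi (f_1,
    .., f_j, g ^ (f_1 .. f_j), f_(j+1), .., f_n)]. *)
Fixpoint homotopy g phi s : V :=
  if s is f :: t then
    phi (g :: f :: t) - homotopy (g ^ f)%g (fun u => phi (f :: u)) t
  else phi [:: g].

Lemma eq_bar_diff n phi psi s : size s = n.+1 ->
  (forall u, size u = n -> phi u = psi u) -> bar_diff phi s = bar_diff psi s.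
Proof.
elim: n phi psi s => [|n IHn] phi psi [|g [|h s]]//=.
  by move=> _ E; rewrite E.
move=> [sn] E; rewrite (E ((g * h)%g :: s)) /= ?sn//; congr (_ - _).
apply: (IHn (fun u => phi (g :: u)) (fun u => psi (g :: u)) (h :: s)).
  by rewrite /= sn.
by move=> u un; apply: E; rewrite /= un.
Qed.

Lemma homotopy_eq0 g phi s :
  (forall u, size u = (size s).+1 -> phi u = 0) -> homotopy g phi s = 0.
Proof.
elim: s g phi => [|f s IHs] g phi E /=; first by rewrite E.
by rewrite E// IHs ?subrr// => u us; apply: E; rewrite /= us.
Qed.

Lemma homotopyD g phi psi s :
  homotopy g (fun u => phi u + psi u) s = homotopy g phi s + homotopy g psi s.
Proof.
elim: s g phi psi => [|f s IHs] g phi psi //=.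
rewrite (IHs _ (fun u => phi (f :: u)) (fun u => psi (f :: u))).
by rewrite opprD addrACA.
Qed.

Lemma homotopyN g phi s : homotopy g (fun u => - phi u) s = - homotopy g phi s.
Proof.
elim: s g phi => [|f s IHs] g phi //=.
by rewrite (IHs _ (fun u => phi (f :: u))) opprB opprK addrC.
Qed.

Lemma bar_diffB phi psi s :
  bar_diff (fun u => phi u - psi u) s = bar_diff phi s - bar_diff psi s.
Proof.
elim: s phi psi => [|f s IHs] phi psi /=; first by rewrite subrr.
rewrite (IHs (fun u => phi (f :: u)) (fun u => psi (f :: u))).
have -> : mul_head f (fun u => phi u - psi u) s =
  mul_head f phi s - mul_head f psi s by case: s {IHs}.
by rewrite !opprB !opprK addrACA [_ + mul_head _ _ _]addrC addrC.
Qed.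

Lemma bar_diff_sum (I : Type) (r : seq I) (phi_ : I -> seq G -> V) s :
  bar_diff (fun u => \sum_(i <- r) phi_ i u) s =
  \sum_(i <- r) bar_diff (phi_ i) s.
Proof.
elim: s phi_ => [|g s IHs] phi_ /=; first by rewrite big1.
rewrite (IHs (fun i u => phi_ i (g :: u))).
have -> : mul_head g (fun u => \sum_(i <- r) phi_ i u) s =
  \sum_(i <- r) mul_head g (phi_ i) s by case: s {IHs}.
by rewrite -!sumrN -big_split.
Qed.

(** The homotopy and the merging of the first two entries; the two ways of
    merging the entries involving [g] agree because [f * g ^ f = g * f]. *)
Lemma homotopy_mul_head f g phi s :
  homotopy (g ^ f)%g (mul_head f phi) s + mul_head f (fun u => phi (g :: u)) s =
  mul_head f (homotopy g phi) s + phi ((g * f)%g :: s).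
Proof.
have E : (f * g ^ f = g * f)%g by rewrite conjgE !mulgA mulgV mul1g.
case: s => [|h s] /=; first by rewrite E addrC.
by rewrite E conjgM addrAC [RHS]addrAC; congr (_ + _); exact: addrC.
Qed.

(** The homotopy anticommutes with the part of the differential without
    action up to the term [- phi], which comes from dropping the conjugate of
    [g] when it is the last entry. *)
Lemma homotopy_bar_diff g phi s :
  homotopy g (bar_diff phi) s = - bar_diff (homotopy g phi) s - phi s.
Proof.
elim: s g phi => [|f s IHs] g phi; first by rewrite /= subr0 oppr0 add0r.
rewrite [LHS]/=.
rewrite (homotopyD _ (fun u => - mul_head f phi u)
  (fun u => - bar_diff (fun u => phi (f :: u)) u)) !homotopyN IHs.
rewrite [in RHS]/= (bar_diffB (fun u => phi (g :: f :: u))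
  (homotopy (g ^ f)%g (fun u => phi (f :: u)))).
have := homotopy_mul_head f g phi s.
set A := homotopy _ (mul_head _ _) _; set B := mul_head _ (fun _ => _) _.
set C := mul_head _ (homotopy _ _) _; set D := phi (_ :: s) => E.
have -> : A = C + D - B by rewrite -E addrK.
set P := bar_diff (fun u => phi [:: g, f & u]) s.
set Q := bar_diff (homotopy _ _) s; set p := phi _.
rewrite !(opprD, opprK) !addrA.
rewrite [LHS](ACl (4 * 3 * 7 * 8 * (1 * 5) * (2 * 6)))%AC/=.
by rewrite addNr subrr !addr0.
Qed.

End ListCochains.

(** * The homotopy on inhomogeneous cochains *)

Section Contract.
Variable G : groupType.
Implicit Types (s t : seq G) (i j n : nat).

(** The list [s] with its entries [i] and [i + 1], counted from [0], merged: the
    counterpart of [contract] for lists. *)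
Fixpoint mul_at i s : seq G :=
  match i, s with
  | 0, g :: h :: t => (g * h)%g :: t
  | i.+1, g :: t => g :: mul_at i t
  | _, _ => s
  end.

Lemma nth_mul_at i s j : (i.+1 < size s)%N ->
  nth 1%g (mul_at i s) j =
    if (j < i)%N then nth 1%g s j
    else if j == i then (nth 1%g s j * nth 1%g s j.+1)%g
    else nth 1%g s j.+1.
Proof.
elim: i s j => [|i IHi] [|g [|h s]] [|j]//= si.
by rewrite IHi//= ltnS eqSS.
Qed.

Lemma bar_diffE (R : pzRingType) (W : lmodType R)
    (phi : seq G -> W) n s : size s = n.+1 ->
  bar_diff phi s =
    \sum_(i < n) (-1) ^+ i.+1 *: phi (mul_at i s)
    + (-1) ^+ n.+1 *: phi (take n s).
Proof.
elim: n phi s => [|n IHn] phi [|g [|h s]]//=.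
  by move=> _; rewrite big_ord0 add0r subr0 expr1 scaleN1r.
move=> [sn]; have := IHn (fun u => phi (g :: u)) (h :: s).
rewrite /= => ->; last by rewrite sn.
rewrite big_ord_recl /= expr1 scaleN1r -addrA; congr (_ + _).
rewrite opprD -sumrN; congr (_ + _); last first.
  by rewrite [in RHS]exprS mulN1r scaleNr.
by apply: eq_bigr => i _; rewrite [in RHS]exprS mulN1r scaleNr.
Qed.

End Contract.

Section Cochains.
Variables (R : realType) (G : groupType) (X : completeNormedModType R).
Variables (pi : banach_module G X) (F : groupClosed G).
Implicit Types (n : nat) (L : seq G).

(** The cochain [phi] as a function of lists; only the values on lists of length
    [n] matter, [1] is a default value. *)
Definition list_cochain n (phi : cochain G X n) (s : seq G) : X :=
  phi (fun i => nth 1%g s i).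

(** The differential of the bar complex, which is the opposite of
    [coboundary]. *)
Definition list_diff (phi : seq G -> X) (s : seq G) : X :=
  if s is g :: t then pi g (phi t) + bar_diff phi s else 0.

Lemma coboundaryE n (phi : cochain G X n) (s : seq G) : size s = n.+1 ->
  coboundary pi phi (fun i => nth 1%g s i) = - list_diff (list_cochain phi) s.
Proof.
case: s => [|g t] // sn; rewrite /list_diff (bar_diffE _ sn) /coboundary.
rewrite !opprD addrA [RHS]addrAC; congr (_ + _ + _).
  rewrite exprS mulN1r scaleNr opprK; congr (_ *: _).
  rewrite /list_cochain; congr phi; apply/funext => i.
  by rewrite lift_max nth_take.
congr (- _); apply: eq_bigr => i _; congr (_ *: _).
rewrite /list_cochain; congr phi; apply/funext => j.
by rewrite /Defs.contract lift_max nth_mul_at ?sn ?ltnS.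
Qed.

Lemma homotopy_list_diff g f (phi : seq G -> X) t :
  homotopy g (list_diff phi) (f :: t) =
  pi g (phi (f :: t)) - phi (f :: t) - pi f (homotopy (g ^ f)%g phi t)
  - bar_diff (homotopy g phi) (f :: t).
Proof.
pose E (psi : seq G -> X) u := if u is h :: v then pi h (psi v) else 0.
have dE : list_diff phi = fun u => E phi u + bar_diff phi u.
  by apply/funext => -[|h u] //=; rewrite addr0.
have piE (h : G) psi u :
    homotopy h (fun v => pi f (psi v)) u = pi f (homotopy h psi u).
  elim: u h psi => [|k u IHu] h psi //=.
  by rewrite (IHu _ (fun v => psi (k :: v))) linearB.
rewrite dE homotopyD homotopy_bar_diff.
rewrite [homotopy g (E phi) _]/= (piE _ phi).
by rewrite !addrA [LHS](ACl (1 * 4 * 2 * 3))%AC.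
Qed.

(** On [F], a cocycle of [G] is cohomologous to its average over a finite family
    of elements of [G] which is invariant under conjugation by [F]. *)
Lemma average_homotopic n (phi : cochain G X n.+1) L :
  coboundary pi phi = 0 -> L != [::] ->
  (forall f, f \in F -> perm_eq [seq (g ^ f)%g | g <- L] L) ->
  exists psi : cochain (subgroup F) X n, forall t : 'I_n.+1 -> subgroup F,
    phi (val \o t) - (size L)%:R^-1 *: \sum_(g <- L) pi g (phi (val \o t)) =
    coboundary (res_module pi F) psi t.
Proof.
move=> phi0 L0 LF.
pose H s := \sum_(g <- L) homotopy g (list_cochain phi) s.
pose psi : cochain G X n := fun t => H [seq t i | i <- enum 'I_n].
exists (res_cochain (F := F) ((size L)%:R^-1 *: psi)) => t.
have cZ a : coboundary pi (a *: psi) = a *: coboundary pi psi.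
  by have := coboundary_is_linear pi a psi 0; rewrite linear0 !addr0.
rewrite res_coboundary cZ.
have sL : (size L)%:R != 0 :> R by rewrite pnatr_eq0 size_eq0.
pose s := [seq val (t i) | i <- enum 'I_n.+1].
have sizes : size s = n.+1 by rewrite size_map size_enum_ord.
have nths : (fun i : 'I_n.+1 => nth 1%g s i) = val \o t.
  apply/funext => i; rewrite /s (nth_map i) ?size_enum_ord//.
  by rewrite nth_ord_enum.
have Fs : forall g, g \in s -> g \in F.
  by move=> g /mapP[i _ ->]; exact: valP.
have -> : res_cochain (F := F) ((size L)%:R^-1 *: coboundary pi psi) t =
  (size L)%:R^-1 *: coboundary pi psi (fun i => nth 1%g s i) by rewrite nths.
rewrite -nths coboundaryE//.
have psiH u : size u = n -> list_cochain psi u = H u.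
  move=> un; rewrite /list_cochain /psi; congr H.
  rewrite -[RHS](@mkseq_nth _ 1%g) un /mkseq -val_enum_ord -map_comp.
  exact: eq_map.
case: s sizes Fs {nths} => // f u [un] Fs.
rewrite -/(list_cochain phi (f :: u)).
have dphi g : homotopy g (list_diff (list_cochain phi)) (f :: u) = 0.
  apply: homotopy_eq0 => v vn; rewrite -[LHS]opprK -coboundaryE.
    by rewrite phi0 oppr0.
  by rewrite vn /= un.
have : \sum_(g <- L) homotopy g (list_diff (list_cochain phi)) (f :: u) = 0.
  by rewrite big1.
under eq_bigr do rewrite homotopy_list_diff.
rewrite 3!sumrB -raddf_sum.
(* The only place where the invariance of [L] is needed. *)
have -> : \sum_(g <- L) homotopy (g ^ f)%g (list_cochain phi) u = H u.
  rewrite -(big_map (fun g => (g ^ f)%g) xpredT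
    (fun g => homotopy g (list_cochain phi) u)).
  by apply: perm_big; apply: LF; apply: Fs; rewrite mem_head.
rewrite big_const_seq count_predT iter_addr_0 -!addrA -opprD => /eqP.
have -> : pi f (H u) +
    \sum_(g <- L) bar_diff (homotopy g (list_cochain phi)) (f :: u) =
    list_diff (list_cochain psi) (f :: u).
  rewrite /list_diff psiH//; congr (_ + _).
  rewrite -bar_diff_sum; apply: (@eq_bar_diff _ _ n) => /=; first by rewrite un.
  by move=> v /psiH.
rewrite addrA subr_eq0 => /eqP <-.
rewrite -[_ phi (f :: u) *+ _]scaler_nat opprB scalerBr scalerA mulVf//.
by rewrite scale1r.
Qed.

End Cochains.

(** * Fixed points of averages *)

(** In a reflexive space, a linear contraction which preserves a nonempty closed
    bounded convex set has a fixed point there: the Cesaro means of an orbit are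
    almost fixed. *)
Lemma contraction_fixed_point (R : realType) (X : normedModType R) (K : set X)
    (M : R) (S : {linear X -> X}) :
  reflexive_space X -> K !=set0 -> closed K -> @convex_set R X K ->
  K `<=` [set x | `|x| <= M] ->
  (forall x, `|S x| <= `|x|) -> (forall x, K x -> K (S x)) ->
  exists2 y, K y & S y = y.
Proof.
move=> refl [x Kx] cK cvK KM S1 KS.
have cS : continuous S.
  apply: (@bounded_linear_continuous _ _ _ S); apply/linear_boundedP.
  exists 1; split=> // r /ltW r1 v; apply: le_trans (S1 v) _.
  by rewrite -[leLHS]mul1r ler_wpM2r.
have Kiter n : K (iter n S x) by elim: n => [//|n]; exact: KS.
pose u n := \sum_(i < n.+1) iter i S x.
have Ku n : K (n.+1%:R^-1 *: u n).
  elim: n => [|n IHn]; first by rewrite /u big_ord1 invr1 scale1r.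
  have n0 m : (m.+1%:R : R) != 0 by rewrite pnatr_eq0.
  have e : n.+2%:R^-1 *: u n.+1 =
      (n.+1%:R / n.+2%:R) *: (n.+1%:R^-1 *: u n) +
      (1 - n.+1%:R / n.+2%:R) *: iter n.+1 S x.
    rewrite /u big_ord_recr/= scalerDr scalerA; congr (_ *: _ + _ *: _).
      by rewrite mulrAC mulfV// mul1r.
    have -> : (n.+2%:R : R) = n.+1%:R + 1 by rewrite -natr1.
    have : 0 < n.+1%:R :> R by rewrite ltr0n.
    by move: (n.+1%:R : R) => m m0; field; rewrite gt_eqF// addr_gt0.
  rewrite e; apply: ((convex_setP _).1 cvK) => //.
  by rewrite ler_pdivrMr ?mul1r ?ler_nat// ltr0n.
have Su n :
    `|S (n.+1%:R^-1 *: u n) - n.+1%:R^-1 *: u n| <= n.+1%:R^-1 * (M + M).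
  rewrite linearZ -scalerBr normrZ ger0_norm ?invr_ge0//.
  apply: ler_wpM2l; first by rewrite invr_ge0.
  have -> : S (u n) - u n = iter n.+1 S x - x.
    rewrite /u linear_sum [in X in X - _]big_ord_recr/=.
    rewrite [in X in _ - X]big_ord_recl/=.
    by rewrite opprD [- x - _]addrC addrACA subrr add0r.
  apply: le_trans (ler_normB _ _) _; apply: lerD; first exact: KM (Kiter n.+1).
  exact: KM.
pose B e := K `&` [set y | `|(S y - y) - 0| <= e].
have lS : linear (fun y => S y - y).
  by move=> a v w; rewrite linearP scalerBr addrACA opprD.
have cSB : continuous (fun y => S y - y).
  by move=> y; apply: cvgB; [exact: cS|exact: cvg_id].
have [||e e0|y yB] := @reflexive_fip R X R [set e | 0 < e] B M refl.
- by exists 1 => /=.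
- move=> i j i0 j0; exists (Num.min i j); first by rewrite /= lt_min i0.
  by move=> y [Ky] /=; rewrite le_min => /andP[yi yj].
- split.
  + have [n _ /(_ _ (leqnn _)) /= nP] := nbhs_infty_ger ((M + M) / e).
    exists (n.+1%:R^-1 *: u n); split=> //=; rewrite subr0.
    apply: le_trans (Su n) _; rewrite ler_pdivrMl ?ltr0n// -ler_pdivrMr//.
    by apply: le_trans nP _; rewrite ler_nat.
  + apply: closedI => //.
    exact: (@closed_norm_le _ _ _ (fun y => S y - y)).
  + apply: convex_setI => //.
    exact: (@convex_norm_le _ _ _ (fun y => S y - y)).
  + by move=> y [/KM].
exists y; first by have [] := yB 1 ltr01.
apply/eqP; rewrite -subr_eq0 -normr_le0; apply/ler_addgt0Pr => e e0.
by have [_ /=] := yB e e0; rewrite subr0 add0r.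
Qed.

Section Means.
Variables (R : realType) (G : groupType) (X : completeNormedModType R).
Variables (pi : banach_module G X).
Hypothesis isom : isometric_module pi.
Implicit Types (L : seq G) (g h : G).

(** The average of the translates of [x] by the entries of [L], with
    multiplicity; it is [0] when [L] is empty. *)
Definition mean L (x : X) : X := (size L)%:R^-1 *: \sum_(g <- L) pi g x.

Lemma mean_is_linear L : linear (mean L).
Proof.
move=> a x y; rewrite /mean; under eq_bigr do rewrite linearP.
by rewrite big_split/= -scaler_sumr scalerDr !scalerA mulrC.
Qed.

HB.instance Definition _ L :=
  GRing.isLinear.Build R X X _ (mean L) (mean_is_linear L).

Lemma mean_contraction L x : `|mean L x| <= `|x|.
Proof.
case: L => [|g L]; first by rewrite /mean big_nil scaler0 normr0.
rewrite /mean normrZ ger0_norm ?invr_ge0// ler_pdivrMl ?ltr0n//.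
apply: le_trans (ler_norm_sum _ _ _) _; under eq_bigr do rewrite isom.
by rewrite big_const_seq count_predT iter_addr_0 mulr_natl.
Qed.

(** The argument of Namioka and Asplund: if [z] is the mean of the points
    [pi g z], these points are all equal to [z]. The closed convex hull of the
    orbit of [z] has a small slice, which contains a point [pi h z] close to the
    supremum of the functional; it then also contains [pi h (pi g z)], since
    [pi h z] is the mean of such points. *)
Lemma mean_fixed L z : separable_space X -> reflexive_space X ->
  mean L z = z -> forall g, g \in L -> pi g z = z.
Proof.
move=> sep refl Lz g gL; apply: contrapT => /eqP gz.
have e0 : 0 < `|pi g z - z| by rewrite normr_gt0 subr_eq0.
pose hull x := forall C, closed C -> @convex_set R X C ->
  (forall h, C (pi h z)) -> C x.
have hull_orbit h : hull (pi h z) by move=> C _ _; exact.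
have cl_hull : closed hull.
  move=> x clx C cC cvC orbC; apply: (cC) => B /clx [y [hy By]].
  by exists y; split=> //; exact: hy C cC cvC orbC.
have cv_hull : @convex_set R X hull.
  apply/convex_setP => s x y s0 s1 hx hy C cC cvC orbC.
  by apply: ((convex_setP _).1 cvC) => //; [exact: hx|exact: hy].
have b_hull : hull `<=` [set x | `|x| <= `|z|].
  move=> x hx; have := hx [set x | `|x - 0| <= `|z|].
  rewrite /= subr0; apply; [exact: closed_ball_le|exact: convex_ball_le|].
  by move=> h; rewrite /= subr0 isom.
have hull0 : hull !=set0 by exists (pi 1%g z).
have [f [c [df [x0 hx0 cx0] small]]] :=
  small_slice sep refl hull0 cl_hull cv_hull b_hull e0.
pose orb := [set f (pi h z) | h in [set: G]].
have sup_orb : has_sup orb.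
  split; first by exists (f (pi 1%g z)), 1%g.
  exists (dual_norm f * `|z|) => _ [h _ <-]; apply: le_trans (ler_norm _) _.
  by apply: le_trans (dual_norm_le df _) _; rewrite isom.
have orb_le h : f (pi h z) <= sup orb.
  by apply: ub_le_sup; [exact: sup_orb.2|exists h].
have c_lt : c < sup orb.
  rewrite ltNge; apply/negP => le_c; move: cx0; rewrite ltNge => /negP; apply.
  have := hx0 [set x | f x <= c]; apply; first exact: closed_halfspace.
    exact: convex_halfspace df.1.
  by move=> h /=; exact: le_trans (orb_le h) le_c.
have L0 : 0 < (size L)%:R :> R by rewrite ltr0n; case: (L) gL.
(* The division by [size L] leaves room for all the terms of the mean but one to
   be as large as the supremum. *)
have d0 : 0 < (sup orb - c) / (size L)%:R by rewrite divr_gt0// subr_gt0.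
have [_ [h _ <-] hP] := sup_adherent d0 sup_orb.
have fsum : \sum_(k <- L) f (pi h (pi k z)) = (size L)%:R * f (pi h z).
  rewrite -{2}Lz /mean linearZ (linZ df.1) regularZ mulrA mulfV ?gt_eqF// mul1r.
  rewrite linear_sum.
  elim: (L) => [|k M IHM]; first by rewrite !big_nil (lin0 df.1).
  by rewrite !big_cons (linD df.1) IHM.
have hg_gt : c < f (pi h (pi g z)).
  have : \sum_(k <- L) f (pi h (pi k z)) =
      f (pi h (pi g z)) + \sum_(k <- rem g L) f (pi h (pi k z)).
    by rewrite (perm_big _ (perm_to_rem gL)) big_cons.
  rewrite fsum.
  have : \sum_(k <- rem g L) f (pi h (pi k z)) <= ((size L)%:R - 1) * sup orb.
    have -> : (size L)%:R - 1 = (size (rem g L))%:R :> R.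
      by rewrite size_rem// -subn1 natrB//; case: (L) gL.
    rewrite mulr_natl -iter_addr_0 -(count_predT (rem g L)) -big_const_seq.
    by apply: ler_sum => k _; rewrite -actM.
  move: hP; rewrite ltrBlDr -ltrBlDl -(ltr_pM2r L0) divfK ?gt_eqF//.
  rewrite mulrBl; move=> h1 h2 h3; nra.
have h_gt : c < f (pi h z).
  apply: le_lt_trans hP; rewrite lerBrDr -lerBrDl.
  rewrite ler_pdivrMr// ler_peMr ?subr_ge0 ?(ltW c_lt)//.
  by rewrite ler1n; case: (L) gL.
have := small _ _ (hull_orbit (h * g)%g) (hull_orbit h).
rewrite actM => /(_ hg_gt h_gt).
by rewrite -linearB isom ltxx.
Qed.

End Means.

(** * Averaging operators *)

Section ConjInvariant.
Variables (G : groupType) (F : groupClosed G).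
Implicit Types (g f : G) (L E : seq G).

(** The family [L], counted with multiplicity, is invariant under conjugation by
    the elements of [F]. *)
Definition conj_invariant L :=
  forall f, f \in F -> perm_eq [seq (g ^ f)%g | g <- L] L.

Lemma conj_invariant_cat L1 L2 :
  conj_invariant L1 -> conj_invariant L2 -> conj_invariant (L1 ++ L2).
Proof. by move=> L1F L2F f fF; rewrite map_cat perm_cat ?L1F ?L2F. Qed.

Lemma FC_conj_invariant g : FC F g -> exists2 L, g \in L & conj_invariant L.
Proof.
move=> /finite_seqP[L0 L0P]; exists (undup L0).
  have : [set` L0] g.
    rewrite -L0P; exists 1%g; first exact: gpred1.
    by rewrite mul1g invg1 mulg1.
  by rewrite /= mem_undup.
have cls h : h \in undup L0 -> exists2 k, k \in F & h = (k * g * k^-1)%g.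
  rewrite mem_undup => hL; have : [set` L0] h by [].
  by rewrite -L0P => -[k kF <-]; exists k.
have clsP k : k \in F -> (k * g * k^-1)%g \in undup L0.
  move=> kF; rewrite mem_undup.
  by have : [set` L0] (k * g * k^-1)%g by rewrite -L0P; exists k.
move=> f fF; apply: uniq_perm; rewrite ?undup_uniq//.
  by rewrite map_inj_uniq ?undup_uniq//; exact: conjg_inj.
move=> h; apply/mapP/idP => [[x /cls[k kF ->] ->]|/cls[k kF ->]].
  have -> : ((k * g * k^-1) ^ f = (f^-1 * k) * g * (f^-1 * k)^-1)%g.
    by rewrite conjgE invgM invgK !mulgA.
  by apply: clsP; apply: gpredM => //; exact: gpredVr.
exists ((f * k) * g * (f * k)^-1)%g; first by apply: clsP; exact: gpredM.
by rewrite conjgE invgM -!mulgA mulVg mulg1 mulKg.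
Qed.

Lemma FC_conj_invariants E : (forall g, g \in E -> FC F g) ->
  exists L, [/\ L != [::], {subset E <= L} & conj_invariant L].
Proof.
elim: E => [|g E IHE] EF.
  exists [:: 1%g]; split=> // f fF.
  by rewrite /= conj1g.
have [|L [L0 EL LF]] := IHE.
  by move=> h hE; apply: EF; rewrite inE hE orbT.
have [L' gL' L'F] := FC_conj_invariant (EF g (mem_head _ _)).
exists (L' ++ L); split; last exact: conj_invariant_cat.
  by rewrite -size_eq0 size_cat addn_eq0 negb_and !size_eq0 L0 orbT.
by move=> h; rewrite inE mem_cat => /predU1P[->|/EL ->]; rewrite ?gL' ?orbT.
Qed.

End ConjInvariant.

Section Averaging.
Variables (R : realType) (G : groupType) (X : completeNormedModType R).
Variables (pi : banach_module G X) (F : groupClosed G).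

(** The convex semigroup of operators generated by the identity and the means
    over the nonempty finite families of elements of [G] which are invariant
    under conjugation by [F]. *)
Inductive averaging : (X -> X) -> Prop :=
| averaging_id : averaging id
| averaging_mean L : L != [::] -> conj_invariant F L -> averaging (mean pi L)
| averaging_comp S T : averaging S -> averaging T -> averaging (S \o T)
| averaging_conv s S T : 0 <= s -> s <= 1 -> averaging S -> averaging T ->
    averaging (fun x => s *: S x + (1 - s) *: T x).

Lemma averaging_linear S : averaging S -> linear S.
Proof.
elim=> {S} [//|L _ _|S T _ lS _ lT|s S T _ _ _ lS _ lT] a x y.
- exact: linearP.
- by rewrite /= lT lS.
- by rewrite lS lT !scalerDr !scalerA addrACA ![_ * a]mulrC.
Qed.

Lemma averaging_contraction S : isometric_module pi ->
  averaging S -> forall x, `|S x| <= `|x|.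
Proof.
move=> isom; elim=> {S} [//|L _ _|S T _ S1 _ T1|s S T s0 s1 _ S1 _ T1] x.
- exact: mean_contraction.
- exact: le_trans (S1 _) (T1 x).
- have s1' : 0 <= 1 - s by rewrite subr_ge0.
  apply: le_trans (ler_normD _ _) _; rewrite !normrZ !ger0_norm//.
  have := ler_wpM2l s0 (S1 x); have := ler_wpM2l s1' (T1 x); lra.
Qed.

Lemma averaging_commute S f x :
  averaging S -> f \in F -> S (pi f x) = pi f (S x).
Proof.
move=> avS fF.
elim: avS x => {S} [//|L _ LF|S T _ Sf _ Tf|s S T _ _ _ Sf _ Tf] x.
- rewrite /mean [RHS]linearZ [in RHS]raddf_sum; congr (_ *: _).
  rewrite -[RHS](perm_big _ (LF _ fF)) big_map; apply: eq_bigr => g _ /=.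
  by rewrite -!actM conjgE !mulgA mulgV mul1g.
- by rewrite /= Tf Sf.
- by rewrite Sf Tf linearP !linearZ.
Qed.

(** An averaging operator acts as the identity on the image of the
    restriction map to the cohomology of [F]. *)
Lemma averaging_homotopic n (phi : cochain G X n.+1) S :
  coboundary pi phi = 0 -> averaging S ->
  exists psi : cochain (subgroup F) X n, forall t : 'I_n.+1 -> subgroup F,
    phi (val \o t) - S (phi (val \o t)) = coboundary (res_module pi F) psi t.
Proof.
move=> phi0; pose d u := @coboundary _ _ _ (res_module pi F) n u.
have dP a u v t : d (a *: u + v) t = a *: d u t + d v t.
  by rewrite /d coboundary_is_linear.
have d0 t : d 0 t = 0.
  by have := dP (-1) 0 0 t; rewrite scaler0 addr0 scaleN1r addNr.
change (averaging S -> exists psi, forall t,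
  phi (val \o t) - S (phi (val \o t)) = d psi t).
elim=> {S} [|L L0 LF|S T avS [p pP] avT [q qP]|s S T _ _ _ [p pP] _ [q qP]].
- by exists 0 => t; rewrite /= subrr d0.
- exact: average_homotopic.
- have lS := averaging_linear avS.
  exists (1 *: p + (fun t => S (q t))) => t; rewrite dP scale1r -pP.
  have -> : d (fun t => S (q t)) t = S (d q t).
    rewrite /d /coboundary !(linD lS) !(linN lS) !(linZ lS).
    congr (- _ + _ - _).
      by rewrite /= averaging_commute//; exact: valP.
    elim: (index_enum _) => [|i r IHr]; first by rewrite !big_nil (lin0 lS).
    by rewrite !big_cons (linD lS) (linZ lS) IHr.
  by rewrite /= -qP (linB lS) addrA subrK.
- exists (s *: p + (1 - s) *: q) => t; rewrite dP -[_ *: q]addr0 dP d0.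
  rewrite addr0 -pP -qP !scalerBr addrACA -scalerDl [s + _]addrC subrK scale1r.
  by rewrite opprD.
Qed.

Hypotheses (sep : separable_space X) (refl : reflexive_space X).
Hypotheses (isom : isometric_module pi).
Hypotheses (fix0 : fixed_points pi (FC F) = [set 0]).

Lemma act_fixed_closed g : closed [set y | pi g y = y].
Proof.
rewrite (_ : mkset _ = [set y | `|(pi g y - y) - 0| <= 0]); last first.
  by apply/seteqP; split=> y /=; rewrite subr0 normr_le0 subr_eq0 => /eqP.
apply: (@closed_norm_le _ _ _ (fun y => pi g y - y)) => y.
by apply: cvgB; [exact: act_continuous|exact: cvg_id].
Qed.

(** The closed convex set [K] of the limits of averages of [x] contains a fixed
    point of each mean over an invariant family, and this point is fixed by all
    members of the family. By weak compactness [K] contains a point fixed by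
    [FC F], that is [0]. *)
Lemma averaging_small x (e : R) : 0 < e -> exists2 S, averaging S & `|S x| < e.
Proof.
pose K y := forall e : R, 0 < e -> exists2 S, averaging S & `|S x - y| < e.
suff K0 : K 0 by move=> /K0[S avS]; rewrite subr0; exists S.
have Kx : K !=set0.
  by exists x => r r0; exists id; [exact: averaging_id|rewrite subrr normr0].
have cK : closed K.
  move=> y clKy r r0; have r20 : 0 < r / 2 by lra.
  have [w [Kw]] := clKy _ (nbhsx_ballx y _ r20).
  rewrite -ball_normE /= => yw; have [S avS Sw] := Kw _ r20; exists S => //.
  have -> : S x - y = (S x - w) - (y - w) by rewrite opprB addrA subrK.
  by apply: le_lt_trans (ler_normB _ _) _; lra.
have cvK : @convex_set R X K.
  apply/convex_setP => s y w s0 s1 Ky Kw r r0.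
  have [S avS Sy] := Ky _ r0; have [T avT Tw] := Kw _ r0.
  exists (fun x => s *: S x + (1 - s) *: T x); first exact: averaging_conv.
  rewrite opprD addrACA -!scalerBr; apply: le_lt_trans (ler_normD _ _) _.
  have s1' : 0 <= 1 - s by lra.
  rewrite !normrZ !ger0_norm//.
  pose m := Num.max `|S x - y| `|T x - w|.
  have mr : m < r by rewrite gt_max Sy.
  apply: le_lt_trans mr.
  have Sm : `|S x - y| <= m by rewrite le_max lexx.
  have Tm : `|T x - w| <= m by rewrite le_max lexx orbT.
  have := ler_wpM2l s0 Sm; have := ler_wpM2l s1' Tm; lra.
have KM : K `<=` [set y | `|y| <= `|x|].
  move=> y Ky /=; apply/ler_addgt0Pr => r r0; have [S avS Sy] := Ky _ r0.
  have -> : y = S x - (S x - y) by rewrite subKr.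
  apply: le_trans (ler_normB _ _) _; apply: lerD; last exact: ltW.
  exact: averaging_contraction.
have KS S : averaging S -> forall y, K y -> K (S y).
  move=> avS y Ky r r0; have [T avT Ty] := Ky _ r0.
  exists (S \o T); first exact: averaging_comp.
  rewrite /= -(linB (averaging_linear avS)); apply: le_lt_trans Ty.
  exact: averaging_contraction.
pose B (E : seq G) := K `&` \bigcap_(g in [set` E]) [set y | pi g y = y].
have [||E EF|y yB] := @reflexive_fip R X (seq G)
    [set E : seq G | forall g, g \in E -> FC F g] B `|x| refl.
- by exists [::].
- move=> E1 E2 E1F E2F; exists (E1 ++ E2).
    by move=> g; rewrite mem_cat => /orP[/E1F|/E2F].
  move=> y [Ky yE].
  split; split=> // g /= gE; apply: yE; rewrite /= mem_cat gE//.
  by rewrite orbT.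
- split.
  + have [L [L0 EL LF]] := FC_conj_invariants EF.
    have [y Ky Ly] := @contraction_fixed_point _ _ K `|x| (mean pi L) refl Kx cK
      cvK KM (mean_contraction isom L) (KS _ (averaging_mean L0 LF)).
    exists y; split=> // g /EL gL; exact: mean_fixed Ly _ gL.
  + by apply: closedI => //; apply: closed_bigI => g _; exact: act_fixed_closed.
  + apply: convex_setI => //; apply/convex_setP => s u v _ _ uE vE g gE /=.
    by rewrite linearP linearZ/= uE// vE.
  + by move=> y [/KM].
have [Ky _] : B [::] y by exact: yB.
have : fixed_points pi (FC F) y.
  move=> g gF; have [_] : B [:: g] y.
    by apply: yB => h; rewrite mem_seq1 => /eqP ->.
  by apply; rewrite /= mem_seq1.
by rewrite fix0 => y0; rewrite -y0.
Qed.

Lemma averaging_small_seq (xs : seq X) (e : R) : 0 < e ->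
  exists2 S, averaging S & forall x, x \in xs -> `|S x| < e.
Proof.
move=> e0; elim: xs => [|x xs [T avT Txs]].
  by exists id => //; exact: averaging_id.
have [S avS Sx] := averaging_small (T x) e0.
exists (S \o T); first exact: averaging_comp.
move=> y; rewrite inE => /predU1P[-> //|/Txs]; apply: le_lt_trans.
exact: (averaging_contraction isom avS).
Qed.

Lemma averaging_small_set (I : Type) (E : set I) (x_ : I -> X) (e : R) :
  finite_set E -> 0 < e ->
  exists2 S, averaging S & forall i, E i -> `|S (x_ i)| < e.
Proof.
move=> /(finite_image x_)/finite_seqP[xs xsE] e0.
have [S avS Sxs] := averaging_small_seq xs e0.
exists S => // i Ei; apply: Sxs.
by have : [set` xs] (x_ i) by rewrite -xsE; exists i.
Qed.

End Averaging.

(** Approximation on finite sets of tuples gives membership in the closure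
    for the topology of pointwise convergence. *)
Lemma closure_pointwise (R : realType) (G : groupType)
    (X : completeNormedModType R) n (B : set (cochain G X n))
    (u : cochain G X n) :
  (forall (E : set ('I_n -> G)) (e : R), finite_set E -> 0 < e ->
    exists2 b, B b & forall t, E t -> `|u t - b t| < e) ->
  closure B u.
Proof.
move=> Bu; rewrite closureEcvg.
pose D := [set p : set ('I_n -> G) * R | finite_set p.1 /\ 0 < p.2].
pose N (p : set ('I_n -> G) * R) :=
  B `&` [set b | forall t, p.1 t -> `|u t - b t| < p.2].
have FN : ProperFilter (filter_from D N).
  apply: filter_from_proper; last first.
    by move=> [E e] [/= fE e0]; have [b Bb bu] := Bu E e fE e0; exists b.
  apply: filter_from_filter; first by exists (set0, 1); split=> /=.
  move=> [E1 e1] [E2 e2] [/= fE1 e10] [/= fE2 e20].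
  exists (E1 `|` E2, Num.min e1 e2).
    by split=> /=; [rewrite finite_setU|rewrite lt_min e10].
  move=> b [Bb bu].
  split; split=> //= t Et; apply: lt_le_trans (bu t _) _ => /=.
  - by left.
  - by rewrite ge_min lexx.
  - by right.
  - by rewrite ge_min lexx orbT.
exists (filter_from D N) => //; split.
  apply/ptws_cvgP => t; apply/cvgrPdist_lt => e e0.
  exists ([set t], e); first by split=> //=; exact: finite_set1.
  by move=> b [_ bu] /=; exact: bu.
move=> A BA; exists (set0, 1); first by split=> /=.
by move=> b [Bb _]; exact: BA.
Qed.

Theorem theorem1p5 (R : realType) (G : groupType)
    (X : completeNormedModType R) (pi : banach_module G X)
    (F : groupClosed G) :
  separable_space X -> reflexive_space X -> isometric_module pi ->
  fixed_points pi (FC F) = [set 0] ->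
  (forall (n : nat) (c : reduced_cohomology pi n),
     res_cohomology F c = 0) /\
  (forall alpha : G -> X -> X, affine_isometric_action pi alpha ->
     almost_fixed_points F alpha).
Proof.
move=> sep refl isom fix0; split; last first.
  move=> alpha [phi alphaE] E e fE EF e0.
  have phi0 : coboundary pi (cocycle_val phi) = 0 by exact/eqP/(valP phi).
  have [S avS SE] := averaging_small_set sep refl isom fix0
    (fun f => cocycle_val phi (fun=> f)) fE e0.
  have [psi psiP] := averaging_homotopic phi0 avS.
  (* [psi] is a cochain of degree [0], that is the point wanted. *)
  exists (psi (fun=> 1%g)) => f Ef; rewrite alphaE.
  have := psiP (fun=> Subgroup (EF f Ef)).
  rewrite /coboundary big_ord0 subr0 scale1r.
  have ffun0 t : psi t = psi (fun=> 1%g) by congr psi; apply/funext => -[].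
  rewrite (ffun0 (fun=> Subgroup _)) => psiE.
  rewrite opprD addrA [psi _ - _]addrC -psiE addrAC subrr add0r normrN.
  exact: SE.
move=> n c; rewrite -[c]reprK res_cohomologyE.
set z := repr c.
suff : res_cocycle F z \in @closed_coboundary _ _ _ (res_module pi F) n.
  rewrite -[X in X \in _]subr0 Quotient.idealrBE => /eqP E.
  apply: etrans E _; exact: raddf0.
apply/asboolP.
have dz : coboundary pi (cocycle_val z) = 0 by exact/eqP/(valP z).
case: n c @z dz => [|n] c z dz.
  (* A cocycle of degree [0] is a point fixed by [G]. *)
  apply: subset_closure; apply/funext => t.
  have : fixed_points pi (FC F) (cocycle_val z (fun=> 1%g)).
    move=> g _.
    have : coboundary pi (cocycle_val z) (fun=> g) = 0 by rewrite dz.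
    have fun0 (v : 'I_0 -> G) : v = fun=> 1%g by apply/funext => -[].
    rewrite /coboundary big_ord0 subr0 scale1r (fun0 (fun=> g)) addrC.
    by move=> /subr0_eq /esym.
  rewrite fix0 => z0; rewrite [RHS](_ : _ = 0)// -z0.
  by congr (cocycle_val z _); apply/funext => -[].
apply: closure_pointwise => E e fE e0.
have [S avS SE] := averaging_small_set sep refl isom fix0
  (fun t => cocycle_val z (fun i => val (t i))) fE e0.
have [psi psiP] := averaging_homotopic dz avS.
exists (coboundary (res_module pi F) psi); first by exists psi.
by move=> t Et; rewrite -psiP subKr; exact: SE.
Qed.
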